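(* Let $\Phi=(\phi_{ij})_{1\le i,j\le n}$ be a freeness-of-trade matrix. Let $\vec a\in\mathbb{R}^n$ be the all ones vector and let $\vec b\in\{-1,1\}^n$ be a $\pm1$ vector. Let $L=\operatorname{diag}(L_1,\dots,L_n)$ be a diagonal matrix with positive diagonal entries such that $\Phi L$ has $\vec a$ and $\vec b$ as eigenvectors, with corresponding eigenvalues $\lambda_a$ and $\lambda_b$, i.e. $\Phi L\vec a=\lambda_a\vec a$ and $\Phi L\vec b=\lambda_b\vec b$. Let $\varepsilon=\frac{\sigma}{\sigma-1}$ with $\sigma>1$. If $$\varepsilon\,\frac{\lambda_b}{\lambda_a}<-1,$$ then the system of equations $$v_i-\sum_{j=1}^n L_j\phi_{ij}v_j^{-\varepsilon}=0,\qquad i=1,\dots,n,$$ does not admit a unique solution $v=(v_1,\dots,v_n)\in(0,\infty)^n$.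
   Context: A real $n\times n$ matrix $\Phi=(\phi_{ij})_{1\le i,j\le n}$ is a freeness-of-trade matrix if for all $i,j,k$: (1) $0<\phi_{ij}\le 1$; (2) $\phi_{ij}\phi_{jk}\le \phi_{ik}$; (3) $\phi_{ij}=\phi_{ji}$; (4) $\phi_{ii}=1$. The displayed system is the equilibrium equation $F(v)=0$, $F_i(v)=v_i-\sum_j L_j\phi_{ij}v_j^{-\varepsilon}$, of the Mossay-Tabuchi trade model with $n$ countries. Here $L_j$ is the mass of workers in country $j$, $\sigma>1$ is the elasticity of substitution, $\varepsilon=\sigma/(\sigma-1)$, and $v_i=\omega_i^\sigma$ where $\omega_i>0$ is the wage in country $i$. *)

(* Defs.v *)
From mathcomp Require Import all_boot all_order all_algebra.
From mathcomp Require Import all_classical all_reals all_analysis.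
Set Implicit Arguments.
Unset Strict Implicit.
Unset Printing Implicit Defensive.
Import Order.TTheory GRing.Theory Num.Theory.
Local Open Scope ring_scope.

Definition freeness_of_trade (R : realType) (n : nat) (Phi : 'M[R]_n) : Prop :=
  [/\ forall i j, 0 < Phi i j <= 1,
      forall i j k, Phi i j * Phi j k <= Phi i k,
      forall i j, Phi i j = Phi j i
    & forall i, Phi i i = 1].

(* Right (column) eigenvectors, unlike the row-vector convention of
   [eigenspace] in mxalgebra. *)
Definition is_eigenvector (R : realType) (n : nat) (A : 'M[R]_n)
    (lambda : R) (u : 'cV[R]_n) : Prop :=
  u != 0 /\ A *m u = lambda *: u.

(* The worker masses L_j are the entries of the row vector [L], so that the
   matrix diag(L_1, ..., L_n) is [diag_mx L]. *)
Definition equilibrium_map (R : realType) (n : nat) (Phi : 'M[R]_n)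
    (L : 'rV[R]_n) (epsilon : R) (v : 'cV[R]_n) (i : 'I_n) : R :=
  v i 0 - \sum_(j < n) L 0 j * Phi i j * v j 0 `^ (- epsilon).

Definition is_equilibrium (R : realType) (n : nat) (Phi : 'M[R]_n)
    (L : 'rV[R]_n) (epsilon : R) (v : 'cV[R]_n) : Prop :=
  (forall i, 0 < v i 0) /\
  (forall i, equilibrium_map Phi L epsilon v i = 0).

(* Main.v *)
(** Look for equilibria that are constant on each of the two level sets of [b],
    equal to [p] where [b = 1] and to [q] where [b = -1].  Since [Phi L] acts on
    the span of the all ones vector and [b] through the two eigenvalues, such a
    vector is an equilibrium iff
      [p + q = lambda_a (p^-e + q^-e)]  and  [p - q = lambda_b (p^-e - q^-e)].
    These equations are symmetric in [(p, q)], so one solution with [p <> q]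
    already gives two equilibria.  With [m = - lambda_b / lambda_a] and
    [r = p / q], eliminating [q] leaves [(r - 1) (r^e + 1) = m (r^e - 1) (r + 1)].
    The left side is smaller just above [r = 1] because [e m > 1], and larger for
    big [r] because [m < 1], which holds by positivity of [Phi L]; the
    intermediate value theorem provides a root [r > 1]. *)
Require Import Defs.
From mathcomp Require Import all_boot all_order all_algebra.
From mathcomp Require Import all_classical all_reals all_analysis.
From mathcomp Require Import ring lra.
Set Implicit Arguments.
Unset Strict Implicit.
Unset Printing Implicit Defensive.
Import Order.TTheory GRing.Theory Num.Theory.
Import numFieldNormedType.Exports.
Local Open Scope ring_scope.

(** Apply [expR x >= 1 + x] twice: at [- ln r], which gives [ln r >= 1 - r^-1], and at
    [e * ln r]. *)
Lemma powR_ge_bernoulli (R : realType) (r e : R) :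
  0 < r -> 0 <= e -> 1 + e * (1 - r^-1) <= r `^ e.
Proof.
move=> r0 e0.
have ln_ge : 1 - r^-1 <= ln r.
  by have := expR_ge1Dx (- ln r); rewrite expRN lnK ?posrE// => ?; lra.
rewrite /powR gt_eqF//; apply: le_trans (expR_ge1Dx _).
by rewrite lerD2l ler_wpM2l.
Qed.

Lemma ratio_equation_solution (R : realType) (e m : R) :
  0 < e -> 0 < m < 1 -> 1 < e * m ->
  exists2 r : R, 1 < r & (r - 1) * (r `^ e + 1) = m * (r `^ e - 1) * (r + 1).
Proof.
move=> e0 /andP[m0 m1] em1.
pose f (r : R) := (r - 1) * (r `^ e + 1) - m * (r `^ e - 1) * (r + 1).
have d0 : 0 < 2 + e - e * m by nra.
have n0 : 0 < 1 - m by lra.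
(* [powR_ge_bernoulli] gives
   [f r <= (r - 1) * (2 + e * ((1 - m) - (1 + m) / r))] for [r <= r2];
   the second factor vanishes at [r1]. *)
pose r1 := (1 + m) * e / (2 + e - e * m).
(* [r2] is the zero of [(1 - m) * r - (1 + m)], the coefficient of [r ^ e] in [f r], so the sign of
   [f r2] is found without estimating the power. *)
pose r2 := (1 + m) / (1 - m).
have r1_gt1 : 1 < r1 by rewrite ltr_pdivlMr// mul1r; lra.
have r1_r2 : r1 < r2 by rewrite ltr_pdivrMr// mulrAC ltr_pdivlMr//; nra.
have r2_root : (1 - m) * r2 = 1 + m by rewrite mulrC divfK// gt_eqF.
have r1_root : (1 + m) * r1^-1 = 2 / e + 1 - m.
  by rewrite /r1; field; apply/and3P; split; apply: lt0r_neq0 => //; lra.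
have fr1 : f r1 <= 0.
  have r1_gt0 : 0 < r1 by lra.
  have s_ge := powR_ge_bernoulli r1_gt0 (ltW e0).
  (* Left of [r2] this coefficient is nonpositive, so the lower bound on the power becomes an upper
     bound on [f r1], equal to 0 by the choice of [r1]. *)
  have slope : (1 - m) * r1 - (1 + m) <= 0 by nra.
  have -> : f r1 = r1 `^ e * ((1 - m) * r1 - (1 + m)) + (1 + m) * r1 - (1 - m).
    by rewrite /f; ring.
  have := ler_wnM2r slope s_ge.
  have -> : (1 + e * (1 - r1^-1)) * ((1 - m) * r1 - (1 + m)) =
            - ((1 + m) * r1 - (1 - m)).
    have -> : (1 - m) * r1 - (1 + m) = - (2 / e) * r1.
      have -> : 1 + m = (2 / e + 1 - m) * r1.
        by rewrite -r1_root divfK// gt_eqF.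
      by ring.
    have -> : (1 + m) * r1 - (1 - m) = 2 / e * r1 + 2 * (r1 - 1).
      have h : 2 / e * r1 + (1 - m) * r1 = 1 + m.
        by rewrite -mulrDl addrA -r1_root divfK// gt_eqF.
      by lra.
    by field; rewrite !gt_eqF.
  by lra.
have fr2 : 0 <= f r2.
  have -> : f r2 = r2 `^ e * ((1 - m) * r2 - (1 + m)) + (1 + m) * r2 - (1 - m).
    by rewrite /f; ring.
  by rewrite r2_root subrr mulr0; nra.
have cf : {within `[r1, r2], continuous f}%classic.
  apply: derivable_within_continuous => x; rewrite in_itv/= => /andP[x1 _].
  have dp : derivable (@powR R ^~ e) x 1.
    by apply: derivable_powR; rewrite in_itv/= andbT; lra.
  have dpD c : derivable (fun r : R => r `^ e + c) x 1 by exact: derivableD.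
  have dxD c : derivable (fun r : R => r + c) x 1 by exact: derivableD.
  have dl := derivableM (dxD (- 1)) (dpD 1).
  have dr := derivableM (derivableM (derivable_cst m x 1) (dpD (- 1))) (dxD 1).
  exact: derivableB dl dr.
(* Starting at [r1 > 1] keeps out the trivial root 1 of [f]. *)
have [|r] := IVT (ltW r1_r2) cf (v := 0).
  by rewrite ge_min fr1 le_max fr2 orbT.
rewrite in_itv/= => /andP[rr1 _] /eqP; rewrite subr_eq0 => /eqP fr.
by exists r => //; lra.
Qed.

Lemma two_level_solution (R : realType) (la lb e : R) :
  0 < e -> 0 < la -> 0 < la + lb -> e * (lb / la) < -1 ->
  exists p q : R, [/\ 0 < p, 0 < q, p != q,
    p + q = la * (p `^ (- e) + q `^ (- e)) &
    p - q = lb * (p `^ (- e) - q `^ (- e))].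
Proof.
move=> e0 la0 lab elam.
pose m := - (lb / la).
have lbE : lb = - m * la by rewrite opprK divfK// gt_eqF.
have m0 : 0 < m by rewrite /m; nra.
have m1 : m < 1 by nra.
have em1 : 1 < e * m by rewrite mulrN; lra.
have [|r r1 rE] := ratio_equation_solution e0 _ em1; first by rewrite m0.
have s0 : 0 < r `^ e by apply: powR_gt0; lra.
set s := r `^ e in rE s0.
(* With [p = r * q], the sum equation forces [q ^ (1 + e) = K]. *)
pose K := la * (s^-1 + 1) / (r + 1).
have K0 : 0 < K.
  by rewrite divr_gt0// ?mulr_gt0// ?addr_gt0// ?invr_gt0//; lra.
pose q := K `^ (1 + e)^-1.
have q0 : 0 < q by exact: powR_gt0.
have qx : q * q `^ e = K.
  rewrite -{1}(powRr1 (ltW q0)) -powRD; last by rewrite (gt_eqF q0) implybT.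
  by rewrite /q -powRrM mulVf ?powRr1 ?gt_eqF//; lra.
have x0 : 0 < q `^ e by exact: powR_gt0.
have pE : (r * q) `^ e = s * q `^ e by rewrite powRM//; lra.
have qE : q = K / q `^ e by rewrite -qx mulfK// gt_eqF.
have r10 : r + 1 != 0 by rewrite gt_eqF//; lra.
exists (r * q), q; split => //.
- by rewrite mulr_gt0//; lra.
- by rewrite -subr_eq0 -{2}(mul1r q) -mulrBl mulf_neq0// gt_eqF//; lra.
- rewrite !powRN pE {1 2}qE /K.
  by field; rewrite r10 !gt_eqF.
- rewrite !powRN pE {1 2}qE /K lbE.
  (* Brings out the left side of [rE], which turns the factor [la] into [m * la = - lb]. *)
  have -> : r * (la * (s^-1 + 1) / (r + 1) / q `^ e) -
            la * (s^-1 + 1) / (r + 1) / q `^ e =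
            la * ((r - 1) * (s + 1)) / (s * (r + 1) * q `^ e).
    by field; rewrite r10 !gt_eqF.
  by rewrite rE; field; rewrite r10 !gt_eqF.
Qed.

Section SignEigenvector.
Variables (R : realType) (n : nat) (Phi : 'M[R]_n) (L : 'rV[R]_n).
Variables (b : 'cV[R]_n) (la lb : R).
Hypothesis hb : forall i, b i 0 = -1 \/ b i 0 = 1.
Hypothesis row_a : forall i, \sum_j Phi i j * L 0 j = la.
Hypothesis row_b : forall i, \sum_j Phi i j * L 0 j * b j 0 = lb * b i 0.

Lemma two_level_equilibrium (e p q : R) : 0 < p -> 0 < q ->
  p + q = la * (p `^ (- e) + q `^ (- e)) ->
  p - q = lb * (p `^ (- e) - q `^ (- e)) ->
  is_equilibrium Phi L e (\col_i (if b i 0 == 1 then p else q)).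
Proof.
move=> p0 q0 hD hB.
(* Writes a two-level vector in terms of the all ones vector and [b]; used for [v] and for its
   power. *)
have split_level (x y : R) i :
    (if b i 0 == 1 then x else y) = (x + y) / 2 + (x - y) / 2 * b i 0.
  by case: (hb i) => ->; [rewrite ifF; last (by apply/eqP; lra) | rewrite eqxx];
    lra.
split=> i; first by rewrite mxE; case: ifP.
rewrite /equilibrium_map mxE.
set P := p `^ _ in hD hB; set Q := q `^ _ in hD hB.
under eq_bigr => j _.
  rewrite mxE.
  have -> : (if b j 0 == 1 then p else q) `^ (- e) =
            (P + Q) / 2 + (P - Q) / 2 * b j 0.
    by rewrite -split_level; case: ifP.
  have -> : L 0 j * Phi i j * ((P + Q) / 2 + (P - Q) / 2 * b j 0) =
            (P + Q) / 2 * (Phi i j * L 0 j) +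
            (P - Q) / 2 * (Phi i j * L 0 j * b j 0) by ring.
  over.
rewrite big_split/= -!mulr_sumr row_a row_b split_level hD hB.
by ring.
Qed.

(** Row [i] of [Phi L] sends the vector [1 + b_i b] to [la + lb]; its entries are 0 or 2, and entry
    [i] is 2. *)
Lemma eigenvalue_sum_gt0 i :
  (forall j, 0 < Phi i j) -> (forall j, 0 < L 0 j) -> 0 < la + lb.
Proof.
move=> Phi0 L0.
have bb : b i 0 * b i 0 = 1 by case: (hb i) => ->; lra.
have -> : la + lb = \sum_j Phi i j * L 0 j * (1 + b j 0 * b i 0).
  under eq_bigr do rewrite mulrDr mulr1 mulrA.
  by rewrite big_split/= -mulr_suml row_a row_b -mulrA bb mulr1.
rewrite (bigD1 i)//= bb ltr_wpDr//; last first.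
  by rewrite !mulr_gt0//; lra.
apply: sumr_ge0 => j _; rewrite mulr_ge0 ?(ltW (mulr_gt0 _ _))//.
by case: (hb j) => ->; case: (hb i) => ->; lra.
Qed.

End SignEigenvector.

Theorem theorem4p3 (R : realType) (n : nat) (Phi : 'M[R]_n) (L : 'rV[R]_n)
    (b : 'cV[R]_n) (lambda_a lambda_b sigma epsilon : R)
    (hPhi : freeness_of_trade Phi)
    (hb : forall i, b i 0 = -1 \/ b i 0 = 1)
    (hL : forall i, 0 < L 0 i)
    (ha_eig : is_eigenvector (Phi *m diag_mx L) lambda_a (const_mx 1))
    (hb_eig : is_eigenvector (Phi *m diag_mx L) lambda_b b)
    (hsigma : 1 < sigma)
    (hepsilon : epsilon = sigma / (sigma - 1))
    (hlambda : epsilon * (lambda_b / lambda_a) < -1) :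
  ~ (exists! v : 'cV[R]_n, is_equilibrium Phi L epsilon v).
Proof.
case: hPhi => Phi01 _ _ _.
have Phi0 i j : 0 < Phi i j by have /andP[] := Phi01 i j.
have e0 : 0 < epsilon by rewrite hepsilon divr_gt0//; lra.
have [a_neq0 a_eig] := ha_eig; have [_ b_eig] := hb_eig.
(* A nonzero vector has an entry, so [n > 0]. *)
have /cV0Pn[i0 _] := a_neq0.
have row_a i : \sum_j Phi i j * L 0 j = lambda_a.
  move/matrixP/(_ i 0): a_eig; rewrite mul_mx_diag !mxE mulr1 => <-.
  by apply: eq_bigr => j _; rewrite !mxE mulr1.
have row_b i : \sum_j Phi i j * L 0 j * b j 0 = lambda_b * b i 0.
  move/matrixP/(_ i 0): b_eig; rewrite mul_mx_diag !mxE => <-.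
  by apply: eq_bigr => j _; rewrite !mxE.
have la0 : 0 < lambda_a.
  rewrite -(row_a i0) (bigD1 i0)//= ltr_wpDr ?mulr_gt0//.
  by apply: sumr_ge0 => j _; rewrite ltW// mulr_gt0.
have lab := eigenvalue_sum_gt0 hb row_a row_b (Phi0 i0) hL.
have [p [q [p0 q0 pq hD hB]]] := two_level_solution e0 la0 lab hlambda.
case=> v [_ v_uniq].
have v_pq := v_uniq _ (two_level_equilibrium hb row_a row_b p0 q0 hD hB).
have v_qp : v = \col_i (if b i 0 == 1 then q else p).
  apply/v_uniq/(two_level_equilibrium hb row_a row_b) => //.
    by rewrite addrC hD [in RHS]addrC.
  by rewrite -opprB hB -mulrN opprB.
move: v_pq; rewrite v_qp => /matrixP/(_ i0 0); rewrite !mxE.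
by case: ifP => _ /eqP; rewrite ?(negbTE pq)// eq_sym (negbTE pq).
Qed.
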